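(* For each positive integer $n$, let $p_n\in(0,1)$, let $\lambda^{(0)}\in\mathcal{P}(n)$ be a (possibly random) initial configuration, and let $(\lambda^{(0)},\lambda^{(1)},\dotsc)$ be the Markov chain on $\mathcal{P}(n)$ defined by the card-based stochastic Bulgarian solitaire $\mathscr{B}(n,p_n)$. Suppose that $p_n\to 0$ as $n\to\infty$ and that $p_n\big/\frac{\log n}{n}\to\infty$ as $n\to\infty$. Let $g(x)=e^{-x}$ for $x\ge 0$. Let $\varepsilon>0$ and, for each $n$, let $m=m(\varepsilon,n)$ be any integer with $m>\frac{\varepsilon^2}{2+\varepsilon}n$. Then the distribution of $\lambda^{(m)}$ on $\mathcal{P}(n)$ has the limit shape $g$ with scaling $1/p_n$ as $n\to\infty$. In fact, $$P\left(\|\partial^{1/p_n}\lambda^{(m)}-g\|_{\infty}\leq\varepsilon\right)\geq 1-\exp\left[-\frac{\varepsilon^2}{2+\varepsilon}\,np_n\bigl(1-o(1)\bigr)\right],$$ where $o(1)$ denotes a quantity tending to $0$ as $n\to\infty$ (for fixed $\varepsilon$ and fixed choices of $p_n$, $\lambda^{(0)}$ and $m$).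
   Context: $\mathcal{P}(n)$ is the set of integer partitions $\lambda=(\lambda_1\ge\lambda_2\ge\dots\ge\lambda_\ell>0)$ of $n$, with the convention $\lambda_i=0$ for $i>\ell$. The card-based stochastic Bulgarian solitaire $\mathscr{B}(n,p)$, with $0<p<1$, is played with $n$ cards distributed in piles. In each move, every card is picked with probability $p$, independently of all other cards (and independently of the past and of the initial configuration), and the picked cards form a new pile (if no card is picked, the configuration is unchanged). Recording the multiset of positive pile sizes as a partition of $n$ gives a Markov chain $(\lambda^{(0)},\lambda^{(1)},\dotsc)$ on $\mathcal{P}(n)$, where $\lambda^{(m)}$ is the configuration after $m$ moves. For a scaling factor $a>0$ and $\lambda\in\mathcal{P}(n)$, the $a$-rescaled diagram-boundary function of $\lambda$ is $\partial^{a}\lambda:\mathbb{R}_{\ge 0}\to\mathbb{R}_{\ge 0}$, $\partial^{a}\lambda(x)=\frac{a}{n}\lambda_{\lfloor ax\rfloor+1}$. For a function $h$ on $[0,\infty)$, $\|h\|_\infty=\sup\{|h(x)|:x\ge 0\}$. A sequence of probability distributions $\nu^{(n)}$ on $\mathcal{P}(n)$, $n\ge 1$, has the limit shape $\phi:\mathbb{R}_{\ge 0}\to\mathbb{R}_{\ge 0}$ with scaling $\{a_n\}$ if, for every $\delta>0$, $\lim_{n\to\infty}\nu^{(n)}\{\lambda\in\mathcal{P}(n):\|\partial^{a_n}\lambda-\phi\|_\infty<\delta\}=1$. *)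

(* Defs.v *)
(* MathComp / MathComp-Analysis. *)
From HB Require Import structures.
From mathcomp Require Import all_boot all_order all_algebra.
From mathcomp Require Import all_classical all_reals all_analysis.

Set Implicit Arguments.
Unset Strict Implicit.
Unset Printing Implicit Defensive.

Import Order.TTheory GRing.Theory Num.Theory.
Import numFieldNormedType.Exports.

Local Open Scope classical_set_scope.
Local Open Scope ring_scope.

(* Parts are listed in weakly decreasing order. *)
Record intpart (n : nat) := IntPart {
  parts :> seq nat;
  partsP : [&& sorted geq parts, all (leq 1) parts & sumn parts == n]
}.

HB.instance Definition _ n := [isSub for @parts n].
HB.instance Definition _ n := [Countable of intpart n by <:].

Fact intpart_ones n : [&& sorted geq (nseq n 1%N), all (leq 1) (nseq n 1%N)
  & sumn (nseq n 1%N) == n].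
Proof.
rewrite sumn_nseq mul1n eqxx andbT all_nseq orbT andbT.
by elim: n => // -[].
Qed.

HB.instance Definition _ n :=
  isPointed.Build (intpart n) (IntPart (intpart_ones n)).

(* Every subset of the finite set of partitions of n is measurable. *)
HB.instance Definition _ n := @isMeasurable.Build default_measure_display
  (intpart n) discrete_measurable discrete_measurable0
  discrete_measurableC discrete_measurableU.

(* The part of index i counted from 0, and 0 beyond the last part. *)
Definition intpart_nth n (la : intpart n) (i : nat) : nat := nth 0%N la i.

Section Move.
Context (n : nat).
Implicit Types (la : intpart n) (S : {set 'I_n}).

(* The n cards are numbered so that the first intpart_nth la 0 cards form pile 0,
   the next intpart_nth la 1 cards form pile 1, and so on. *)
Definition pile la (i : nat) : {set 'I_n} :=
  [set c : 'I_n | reshape_index la c == i]%SET.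

Lemma sumn_intpart la : sumn la = n.
Proof. by case: la => s /= /and3P[_ _ /eqP]. Qed.

Lemma card_pile la i : #|pile la i| = intpart_nth la i.
Proof.
have Hsum := sumn_intpart la.
have inj (c : 'I_(intpart_nth la i)) : (flatten_index la i c < n)%N.
  by rewrite -[X in (_ < X)%N]Hsum flatten_indexP.
pose f c := Ordinal (inj c).
have -> : pile la i = [set f c | c in finset.setT]%SET.
  apply/setP => c; rewrite inE; apply/eqP/imsetP => [ci|[d _ ->]]; last first.
    by rewrite /= flatten_indexKl.
  have lt_c : (reshape_offset la c < intpart_nth la i)%N.
    by rewrite -ci reshape_offsetP // Hsum.
  exists (Ordinal lt_c); rewrite ?inE //; apply: val_inj.
  by rewrite /= -[in RHS]ci reshape_indexK.
rewrite card_imset ?cardsT ?card_ord // => c d /(congr1 val) /= /addnI.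
exact: val_inj.
Qed.

(* The cards of S leave their piles and form a new pile; empty piles
   disappear. *)
Definition solitaire_parts la S : seq nat :=
  sort geq
    [seq k <- #|S| :: [seq #|pile la i :\: S|%SET | i <- iota 0 (size la)]
    | (0 < k)%N].

Lemma sumn_filter_pos (s : seq nat) : sumn [seq k <- s | (0 < k)%N] = sumn s.
Proof. by elim: s => //= -[|k] s /= ->. Qed.

Lemma solitaire_partsP la S : [&& sorted geq (solitaire_parts la S),
  all (leq 1) (solitaire_parts la S) & sumn (solitaire_parts la S) == n].
Proof.
rewrite sort_sorted => [|x y]; last exact: leq_total.
rewrite all_sort filter_all /=.
rewrite (perm_sumn (permEl (perm_sort _ _))) sumn_filter_pos /=.
rewrite sumnE big_map -[X in iota _ X]subn0 -/(index_iota 0 (size la)) big_mkord.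
suff -> : (\sum_(i < size la) #|pile la i :\: S|%SET)%N = #|~: S|%SET.
  by rewrite cardsC card_ord.
under eq_bigr do rewrite -sum1_card.
rewrite -sum1_card (partition_big (fun c : 'I_n => inord (reshape_index la c) :
  'I_(size la).-1.+1) predT) //=.
have [s0|s0] := posnP (size la).
  rewrite [in LHS]s0 big_ord0 big1 // => i _; apply: big1 => c.
  suff: (c < 0)%N by [].
  by rewrite (leq_trans (ltn_ord c)) // -(sumn_intpart la) (size0nil s0).
rewrite -[in LHS](prednK s0); apply: eq_bigr => i _; apply: eq_bigl => c.
have lt_c : (reshape_index la c < (size la).-1.+1)%N.
  by rewrite prednK // reshape_indexP // sumn_intpart.
by rewrite !inE -val_eqE /= inordK // andbC.
Qed.

Definition solitaire_move la S : intpart n := IntPart (solitaire_partsP la S).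

Lemma solitaire_move_set0 la : solitaire_move la finset.set0 = la.
Proof.
apply: val_inj; rewrite /= /solitaire_parts cards0 /=.
have -> : [seq #|pile la i :\: finset.set0|%SET | i <- iota 0 (size la)] = la.
  rewrite -[RHS](mkseq_nth 0%N); apply: eq_map => i.
  by rewrite finset.setD0 card_pile.
case: la => s /= /and3P[ss /all_filterP -> _]; apply: sorted_sort => //.
by move=> x y z yx xz; exact: leq_trans xz yx.
Qed.

End Move.

Section Solitaire.
Context {R : realType}.

(* Transition probability of the card-based stochastic Bulgarian solitaire: S is
   the random set of picked cards, each card being in S independently with
   probability p. *)
Definition solitaire_kernel n (p : R) (la mu : intpart n) : R :=
  \sum_(S : {set 'I_n} | solitaire_move la S == mu)
    \prod_(c : 'I_n) (if c \in S then p else 1 - p).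

(* Markov chain with transition probabilities K and arbitrary initial law, on a
   countable discrete state space E. The condition is the product form of
   P(X_(k+1) = s_(k+1) | X_0 = s_0, .., X_k = s_k) = K s_k s_(k+1), which needs no
   hypothesis that the conditioning event has positive probability. *)
Definition markov_chain d (Omega : measurableType d)
    (P : probability Omega R) dE (E : measurableType dE) (K : E -> E -> R)
    (X : nat -> {RV P >-> E}) : Prop :=
  forall (k : nat) (s : nat -> E),
    P [set w | forall j, (j <= k.+1)%N -> X j w = s j] =
    (P [set w | forall j, (j <= k)%N -> X j w = s j]
      * (K (s k) (s k.+1))%:E)%E.

(* For a, x >= 0, Num.truncn (a * x) is the floor of a * x. Parts are indexed from
   0, so this is the part of index floor (a * x) + 1 when counting from 1. *)
Definition diagram_boundary n (a : R) (la : intpart n) : R -> R :=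
  fun x => a / n%:R * (intpart_nth la (Num.truncn (a * x)))%:R.

(* The norm over the half-line x >= 0 only; it may be infinite. *)
Definition sup_norm_ge0 (h : R -> R) : \bar R :=
  ereal_sup [set (`|h x|)%:E | x in [set x | 0 <= x]].

(* phi is a function on the half-line; its values at x < 0 play no role.
   The index n = 0 plays no role either. *)
Definition limit_shape (nu : forall n, probability (intpart n) R)
    (phi : R -> R) (a : nat -> R) : Prop :=
  [/\ forall x, 0 <= x -> 0 <= phi x,
      forall n, (0 < n)%N -> 0 < a n
    & forall delta : R, 0 < delta ->
        nu n [set la |
          (sup_norm_ge0 (diagram_boundary (a n) la \- phi)%R < delta%:E)%E]
          @[n --> \oo] --> 1%E].

End Solitaire.

(* Main.v *)
(* Number the cards once and for all and label each pile by its age; the law of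
   the picks does not depend on the numbering, so the sorted pile sizes of this
   labelled process form the chain on partitions. After M moves the age of a card
   picked during these moves is i < M with probability p (1-p)^i, independently
   for distinct cards, so the pile of age i has a binomial size with mean
   n p (1-p)^i, and Chernoff's bound with parameter ln (1 + eta) controls its
   deviation by eta n p. With M just above eps^2 / (2 + eps) n, all cards have
   been picked except with probability n (1-p)^M, which is of the same order as
   the Chernoff bound for eta = eps - p; a union bound over the M piles costs
   only a factor O(n), absorbed in the exponent since log n = o(n p). Moves
   before the last M play no role. Finally sorting does not increase the uniform
   distance to the nonincreasing profile n p (1-p)^i, which is within n p^2 of
   the rescaled exponential. *)

Require Import Defs.
From HB Require Import structures.
From mathcomp Require Import all_boot all_order all_algebra all_fingroup.
From mathcomp Require Import all_classical all_reals all_analysis.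
From mathcomp Require Import ring lra zify.

Set Implicit Arguments.
Unset Strict Implicit.
Unset Printing Implicit Defensive.

Import Order.TTheory GRing.Theory Num.Theory.
Import numFieldNormedType.Exports.

Local Open Scope classical_set_scope.
Local Open Scope ring_scope.

(** * Labelled configurations *)

Section Shape.
Context (n : nat).
Implicit Types (f g : 'I_n -> nat) (S : {set 'I_n}) (la : intpart n).

Definition fiber_card f (l : nat) : nat := count_mem l (codom f).

Lemma fiber_cardE f l : fiber_card f l = #|[set c | f c == l]%SET|.
Proof.
by rewrite /fiber_card count_map -size_filter cardsE cardE enumT.
Qed.

Definition shape_parts f : seq nat :=
  sort geq [seq fiber_card f l | l <- undup (codom f)].

Lemma shape_partsP f : [&& sorted geq (shape_parts f),
  all (leq 1) (shape_parts f) & sumn (shape_parts f) == n].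
Proof.
rewrite sort_sorted => [|x y]; last exact: leq_total.
rewrite all_sort (perm_sumn (permEl (perm_sort _ _))) all_map /=.
apply/andP; split.
  by apply/allP => l; rewrite mem_undup /= -has_count has_pred1.
have := perm_size (perm_count_undup (codom f)).
rewrite size_flatten /shape -map_comp size_codom card_ord => cE.
apply/eqP; rewrite -[RHS]cE; congr sumn.
by apply: eq_map => l /=; rewrite size_nseq.
Qed.

Definition shape_of f : intpart n := IntPart (shape_partsP f).

(** [L] may contain labels that no card carries: they give zeros, which the filter removes. *)
Lemma perm_shape f (L : seq nat) : uniq L -> {subset codom f <= L} ->
  perm_eq (shape_of f) [seq k <- [seq fiber_card f l | l <- L] | (0 < k)%N].
Proof.
move=> uL sL; rewrite /= /shape_parts (permPl (permEl (perm_sort _ _))).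
rewrite filter_map; apply: perm_map; apply: uniq_perm.
- exact: undup_uniq.
- exact: filter_uniq.
move=> l; rewrite mem_undup mem_filter /= /fiber_card -has_count has_pred1.
by case: (boolP (l \in codom f)) => //= /sL ->.
Qed.

Lemma intpart_sorted la : sorted geq la.
Proof. by case: la => s /= /and3P[]. Qed.

Lemma intpart_perm (la mu : intpart n) : perm_eq la mu -> la = mu.
Proof.
move=> pe; apply: val_inj; apply: (@sorted_eq _ geq) => //.
- by move=> x y z yx xz; exact: leq_trans xz yx.
- by move=> x y; rewrite /geq /= => xy; apply/eqP; rewrite eqn_leq andbC.
- exact: intpart_sorted.
- exact: intpart_sorted.
Qed.

(** Lets the labelled process start from any partition. *)
Lemma shape_of_pile la : shape_of (fun c => reshape_index la c) = la.
Proof.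
apply: intpart_perm.
rewrite (permPl (perm_shape (iota_uniq 0 (size la)) _)); last first.
  move=> l /codomP[c ->]; rewrite mem_iota /=.
  by rewrite reshape_indexP // sumn_intpart.
have -> : [seq fiber_card (fun c : 'I_n => reshape_index la c) l
          | l <- iota 0 (size la)] = la.
  rewrite -[RHS](mkseq_nth 0%N); apply: eq_map => i.
  by rewrite fiber_cardE -/(pile la i) card_pile.
by case: la => s /= /and3P[_ /all_filterP -> _].
Qed.

(* Labels of piles are ages: the new pile gets label 0, the others grow by 1. *)
Definition relabel f S : 'I_n -> nat :=
  fun c => if c \in S then 0%N else (f c).+1.

Lemma shape_of_perm f (sigma : {perm 'I_n}) :
  shape_of (fun c => f (sigma c)) = shape_of f.
Proof.
have fE l : fiber_card (fun c => f (sigma c)) l = fiber_card f l.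
  rewrite !fiber_cardE -(card_imset _ (@perm_inj _ sigma)).
  congr #|pred_of_set _|; apply/setP => c; rewrite [RHS]inE.
  apply/imsetP/idP => [[d + ->]|fc]; first by rewrite inE.
  by exists ((sigma^-1)%g c); rewrite ?inE permKV.
have uL := undup_uniq (codom f).
apply: intpart_perm; rewrite (permPl (perm_shape uL _)); last first.
  by move=> l /codomP[c ->]; rewrite mem_undup codom_f.
rewrite perm_sym (permPl (perm_shape uL _)); last first.
  by move=> l; rewrite mem_undup.
by rewrite (eq_map fE).
Qed.

(* Listing the cards pile by pile, in the order of the parts of shape_of f,
   turns the labels f into the numbering of piles used by solitaire_move. *)
Lemma relabel_solitaire_move f : exists sigma : {perm 'I_n}, forall S,
  shape_of (relabel f (sigma @: S)%SET) = solitaire_move (shape_of f) S.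
Proof.
(* Labels by weakly decreasing pile size, so that the [i]-th label of [L] belongs to part [i] of
   [la]. *)
pose L := sort (relpre (fiber_card f) geq) (undup (codom f)).
have pL : perm_eq L (undup (codom f)) by exact/permEl/perm_sort.
have uL : uniq L by rewrite (perm_uniq pL) undup_uniq.
have memL l : (l \in L) = (l \in codom f) by rewrite (perm_mem pL) mem_undup.
set la := shape_of f.
have laE : la = [seq fiber_card f l | l <- L] :> seq nat.
  by rewrite /= /shape_parts sort_map.
have szL : size L = size la by rewrite laE size_map.
pose Css := [seq [seq c <- enum 'I_n | f c == l] | l <- L].
have shCss : shape Css = la.
  rewrite laE /shape -map_comp; apply: eq_map => l /=.
  by rewrite /fiber_card count_map -size_filter enumT.
(* [nth] below needs a default card, which exists only for [n > 0]. *)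
have [n0|n_gt0] := posnP n.
  exists 1%g => S; apply: intpart_perm.
  have nil (mu : intpart n) : mu = [::] :> seq nat.
    case: mu => -[|x s] //= /and3P[_ /andP[x0 _] /eqP]; lia.
  by rewrite [X in perm_eq _ X]nil nil.
pose c0 := Ordinal n_gt0.
pose Cs := flatten Css.
have szCs : size Cs = n.
  by rewrite size_flatten shCss sumn_intpart.
have memCs c : c \in Cs.
  apply/flattenP; exists [seq c' <- enum 'I_n | f c' == f c].
    by apply/mapP; exists (f c) => //; rewrite memL codom_f.
  by rewrite mem_filter eqxx mem_enum.
have uCs : uniq Cs.
  apply/card_uniqP; rewrite szCs -[RHS]card_ord; apply: eq_card => c.
  by rewrite memCs.
(* [Cs] lists each card once, pile by pile, so reading it by position is a permutation; position [c]
   lies in pile [r c]. *)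
pose sg (c : 'I_n) := nth c0 Cs c.
have sg_inj : injective sg.
  move=> c d /eqP; rewrite nth_uniq ?szCs // => /eqP cd; exact: val_inj.
pose r (c : 'I_n) := reshape_index la c.
have r_lt c : (r c < size L)%N.
  by rewrite szL reshape_indexP // sumn_intpart.
have fsg c : f (sg c) = nth 0%N L (r c).
  rewrite /sg nth_flatten shCss -/(r c) (nth_map 0%N) //.
  set s := [seq _ <- _ | _].
  suff : nth c0 s (reshape_offset la c) \in s.
    by rewrite mem_filter => /andP[/eqP].
  apply: mem_nth.
  have : (reshape_offset la c < nth 0 la (r c))%N.
    by apply: reshape_offsetP; rewrite sumn_intpart.
  move/leq_trans; apply.
  have /esym -> := congr1 (nth 0%N ^~ (r c)) shCss.
  by rewrite /shape -map_comp (nth_map 0%N).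
exists (perm sg_inj) => S.
(* Renumbering by the same permutation turns the picked set into [S] itself. *)
rewrite -(shape_of_perm _ (perm sg_inj)).
set h := fun c => _.
have hE c : h c = if c \in S then 0%N else (nth 0%N L (r c)).+1.
  by rewrite /h /relabel mem_imset ?permE ?fsg //; exact: perm_inj.
have uL' : uniq (0%N :: [seq l.+1 | l <- L]).
  rewrite /= map_inj_uniq ?uL ?andbT //; last by move=> x y [].
  by apply/mapP => -[].
apply: intpart_perm; rewrite (permPl (perm_shape uL' _)); last first.
  move=> l /codomP[c ->]; rewrite hE; case: ifP => _; rewrite ?mem_head //.
  by rewrite inE orFb; apply/map_f/mem_nth.
rewrite perm_sym -[parts _]/(solitaire_parts la S) /solitaire_parts.
rewrite (permPl (permEl (perm_sort _ _))).
apply: perm_filter; rewrite map_cons.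
have -> : fiber_card h 0 = #|S|.
  rewrite fiber_cardE; apply: eq_card => c; rewrite inE hE.
  by case: ifP.
rewrite perm_cons.
have -> : [seq fiber_card h l | l <- [seq l.+1 | l <- L]]
    = [seq fiber_card h (nth 0%N L i).+1 | i <- iota 0 (size la)].
  rewrite -szL -{1}(mkseq_nth 0%N L) /mkseq -!map_comp //.
set s1 := map _ _; set s2 := map _ _.
suff -> : s1 = s2 by [].
apply/eq_in_map => i; rewrite mem_iota /= -szL => iL.
rewrite fiber_cardE; apply: eq_card => c; rewrite !inE hE.
by case: (c \in S) => //=; rewrite eqSS nth_uniq.
Qed.

Lemma count_shape f (L : seq nat) t : (0 < t)%N -> uniq L ->
  {subset codom f <= L} ->
  count (leq t) (shape_of f) = count (fun l => (t <= fiber_card f l)%N) L.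
Proof.
move=> t0 uL sL; rewrite (seq.permP (perm_shape uL sL)) count_filter count_map.
by apply: eq_count => l /=; case: (fiber_card f l) => [|k] /=; lia.
Qed.

(** Parts decrease weakly, so those at least [t] form a prefix, whose length is a part of the
    conjugate partition. *)
Lemma lt_count_nth la k t : (0 < t)%N ->
  (k < count (leq t) la)%N = (t <= intpart_nth la k)%N.
Proof.
move=> t0; rewrite /intpart_nth; move: (intpart_sorted la).
elim: (la : seq nat) k => [|x s IH] k /=.
  by rewrite nth_nil; lia.
move=> xs; have ss := path_sorted xs.
have [tx|xt] := leqP t x.
  by case: k => [|k] /=; rewrite ?tx // add1n ltnS IH.
rewrite add0n IH //.
have geq_trans : transitive geq by move=> a b c ba ac; exact: leq_trans ac ba.
have /allP sx := order_path_min geq_trans xs.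
have small j : (nth 0%N s j <= x)%N.
  have [js|js] := ltnP j (size s); last by rewrite nth_default.
  exact/sx/mem_nth.
case: k => [|k] /=; first by have := small 0%N; lia.
by have := small k; have := small k.+1; lia.
Qed.

End Shape.

(* Sorting preserves super-level counts, so it does not increase the uniform
   distance to a nonincreasing profile. *)
Lemma shape_of_close (R : realDomainType) (n : nat) (f : 'I_n -> nat)
    (q : nat -> R) (D : R) :
  (forall i j, (i <= j)%N -> q j <= q i) ->
  (forall l, `|(fiber_card f l)%:R - q l| <= D) ->
  forall k, `|(intpart_nth (shape_of f) k)%:R - q k| <= D.
Proof.
move=> q_noninc fq k; set t := intpart_nth _ k.
pose B := maxn k.+1 (\max_c f c).+1.
have uL := iota_uniq 0 B.
have sL : {subset codom f <= iota 0 B}.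
  move=> l /codomP[c ->]; rewrite mem_iota /= /B leq_max; apply/orP; right.
  by rewrite ltnS (leq_bigmax c).
rewrite ler_distl; apply/andP; split; rewrite leNgt; apply/negP => tq.
  (* If part [k] were below [q k - D], the labels 0, ..., [k] would all have fibers larger than [t],
     so more than [k] parts would exceed part [k]. *)
  have : (k < count (leq t.+1) (shape_of f))%N.
    rewrite (count_shape _ uL sL) // -size_filter -{1}(size_iota 0 k.+1).
    apply: uniq_leq_size; first exact: iota_uniq.
    move=> l; rewrite mem_iota add0n /= => lk.
    rewrite mem_filter mem_iota /B leq_max (leq_trans lk) // andbT.
    rewrite -(ltr_nat R); apply: lt_le_trans tq _.
    apply: (@le_trans _ _ (q l - D)); first by rewrite lerB // q_noninc.
    by have := fq l; rewrite ler_distl => /andP[].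
  by rewrite lt_count_nth // ltnn.
have fle l : (fiber_card f l)%:R <= q l + D.
  by have := fq l; rewrite ler_distl => /andP[].
have t_gt0 : (0 < t)%N.
  by rewrite -(ltr_nat R); apply: le_lt_trans tq; apply: le_trans (fle k).
(* If part [k] were above [q k + D], every label with at least [t] cards would be smaller than [k],
   leaving at most [k] such labels. *)
have : (k < count (leq t) (shape_of f))%N by rewrite lt_count_nth.
rewrite (count_shape _ uL sL) // ltnNge => /negP; apply.
rewrite -size_filter -[X in (_ <= X)%N](size_iota 0 k); apply: uniq_leq_size.
  exact: filter_uniq.
move=> l; rewrite mem_filter => /andP[tl _].
rewrite mem_iota /= add0n ltnNge; apply/negP => kl.
have : t%:R <= q k + D.
  apply: le_trans (_ : q l + D <= _); last by rewrite lerD2r q_noninc.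
  by apply: le_trans (fle l); rewrite ler_nat.
by rewrite leNgt tq.
Qed.

(** * Averages over the picked cards *)

Section Average.
Context {R : realType} (n : nat) (p : R).
Implicit Types (f : 'I_n -> nat) (h : ('I_n -> nat) -> R) (S : {set 'I_n}).
Hypothesis p01 : 0 <= p <= 1.

Definition pick_weight S : R := \prod_(c : 'I_n) (if c \in S then p else 1 - p).

Definition move_mean (h : intpart n -> R) (la : intpart n) : R :=
  \sum_(S : {set 'I_n}) pick_weight S * h (solitaire_move la S).

Definition relabel_mean h f : R :=
  \sum_(S : {set 'I_n}) pick_weight S * h (relabel f S).

Lemma pick_weight_ge0 S : 0 <= pick_weight S.
Proof.
case/andP: p01 => p0 p1; apply: prodr_ge0 => c _.
by case: ifP => _ //; rewrite subr_ge0.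
Qed.

Lemma pick_weight_imset S (sigma : {perm 'I_n}) :
  pick_weight (sigma @: S)%SET = pick_weight S.
Proof.
rewrite /pick_weight (reindex_inj (@perm_inj _ sigma)) /=.
by apply: eq_bigr => c _; rewrite mem_imset //; exact: perm_inj.
Qed.

(** The weight of a picked set is invariant under permutations, so the sum can be reindexed by the
    permutation of [relabel_solitaire_move]. *)
Lemma move_mean_shape (h : intpart n -> R) f :
  move_mean h (shape_of f) = relabel_mean (h \o @shape_of n) f.
Proof.
have [sigma sigmaE] := relabel_solitaire_move f.
rewrite /relabel_mean (reindex_inj (imset_inj (@perm_inj _ sigma))) /=.
by apply: eq_bigr => S _; rewrite pick_weight_imset sigmaE.
Qed.

Lemma iter_move_mean_shape (h : intpart n -> R) M f :
  iter M move_mean h (shape_of f) = iter M relabel_mean (h \o @shape_of n) f.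
Proof.
elim: M f => //= M IH f; rewrite move_mean_shape.
by apply: eq_bigr => S _; rewrite /= IH.
Qed.

Lemma eq_iter_relabel_mean M h1 h2 : h1 =1 h2 ->
  iter M relabel_mean h1 =1 iter M relabel_mean h2.
Proof.
move=> h12; elim: M => //= M IH f.
by apply: eq_bigr => S _; rewrite IH.
Qed.

Lemma iter_relabel_mean_le M h1 h2 f : (forall f', h1 f' <= h2 f') ->
  iter M relabel_mean h1 f <= iter M relabel_mean h2 f.
Proof.
move=> h12; elim: M f => //= M IH f.
by apply: ler_sum => S _; rewrite ler_wpM2l // pick_weight_ge0.
Qed.

Lemma iter_relabel_meanD M h1 h2 f :
  iter M relabel_mean (fun f' => h1 f' + h2 f') f =
  iter M relabel_mean h1 f + iter M relabel_mean h2 f.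
Proof.
elim: M f => //= M IH f; rewrite /relabel_mean -big_split /=.
by apply: eq_bigr => S _; rewrite IH mulrDr.
Qed.

Lemma iter_relabel_meanZ M k h f :
  iter M relabel_mean (fun f' => k * h f') f = k * iter M relabel_mean h f.
Proof.
elim: M f => //= M IH f; rewrite /relabel_mean mulr_sumr.
by apply: eq_bigr => S _; rewrite IH mulrCA.
Qed.

Lemma iter_relabel_mean_sum M (J : finType) (h : J -> ('I_n -> nat) -> R) f :
  iter M relabel_mean (fun f' => \sum_j h j f') f =
  \sum_j iter M relabel_mean (h j) f.
Proof.
elim: M f => //= M IH f; rewrite /relabel_mean exchange_big /=.
by apply: eq_bigr => S _; rewrite IH mulr_sumr.
Qed.

(** Transition operator of the age of a single card. *)
Definition age_mean (u : nat -> R) (x : nat) : R :=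
  p * u 0%N + (1 - p) * u x.+1.

(* Picks of distinct cards are independent, so averages of products factor. *)
Lemma iter_relabel_mean_prod M (u : 'I_n -> nat -> R) f :
  iter M relabel_mean (fun f' => \prod_c u c (f' c)) f =
  \prod_c iter M age_mean (u c) (f c).
Proof.
elim: M f => //= M IH f; rewrite /relabel_mean.
under [LHS]eq_bigr do rewrite IH -big_split /=.
rewrite [RHS]bigA_distr; apply: eq_bigr => S _; apply: eq_bigr => c _.
by rewrite /relabel; case: ifP.
Qed.

(** Age [l < M] means that the last pick was followed by [l] moves without one; a card never picked
    has aged by [M]. *)
Lemma iter_age_mean M (u : nat -> R) x :
  iter M age_mean u x =
  \sum_(l < M) p * (1 - p) ^+ l * u l + (1 - p) ^+ M * u (x + M)%N.
Proof.
elim: M x => [|M IH] x; first by rewrite big_ord0 add0r mul1r addn0.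
rewrite /= /age_mean !IH big_ord_recr /= add0n addSnnS exprS; ring.
Qed.

Lemma sum_geometric M : \sum_(l < M) p * (1 - p) ^+ l = 1 - (1 - p) ^+ M.
Proof.
elim: M => [|M IH]; first by rewrite big_ord0 subrr.
by rewrite big_ord_recr /= IH exprS; ring.
Qed.

Lemma iter_age_mean1 M x : iter M age_mean (fun=> 1) x = 1.
Proof.
rewrite iter_age_mean mulr1; under eq_bigr do rewrite mulr1.
by rewrite sum_geometric subrK.
Qed.

Lemma iter_relabel_mean_cst M (k : R) f :
  iter M relabel_mean (fun=> k) f = k.
Proof.
rewrite (@eq_iter_relabel_mean _ _ (fun f' => k * \prod_(c < n) 1)).
  rewrite iter_relabel_meanZ (iter_relabel_mean_prod _ (fun _ _ => 1)).
  by rewrite big1 ?mulr1 // => c _; rewrite iter_age_mean1.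
by move=> f'; rewrite big1 ?mulr1.
Qed.

Lemma iter_relabel_mean_unpicked M f (c : 'I_n) :
  iter M relabel_mean (fun f' => (M <= f' c)%:R) f = (1 - p) ^+ M.
Proof.
(* The indicator is a product over the cards with all factors 1 except at [c]. *)
pose u (c' : 'I_n) (x : nat) : R := if c' == c then (M <= x)%:R else 1.
rewrite (@eq_iter_relabel_mean _ _ (fun f' => \prod_c' u c' (f' c'))).
  rewrite iter_relabel_mean_prod (bigD1 c) //= [X in _ * X]big1 ?mulr1.
    rewrite /u eqxx iter_age_mean leq_addl mulr1 big1 ?add0r // => l _.
    by rewrite leqNgt ltn_ord mulr0.
  by move=> c' /negPf c'c; rewrite /u c'c iter_age_mean1.
move=> f'; rewrite (bigD1 c) //= big1 ?mulr1 /u ?eqxx //.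
by move=> c' /negPf ->.
Qed.

Lemma fiber_card_sum f l : fiber_card f l = (\sum_c (f c == l))%N.
Proof.
rewrite fiber_cardE -sum1_card big_mkcond /=.
by apply: eq_bigr => c _; rewrite inE; case: eqP.
Qed.

(** This is the moment generating function of a binomial variable. The initial labels disappear
    because a card never picked has age at least [M > i]. *)
Lemma iter_relabel_mean_expR M f (i : nat) (theta : R) : (i < M)%N ->
  iter M relabel_mean (fun f' => expR (theta * (fiber_card f' i)%:R)) f =
  (1 + p * (1 - p) ^+ i * (expR theta - 1)) ^+ n.
Proof.
move=> iM.
pose u (x : nat) : R := expR (theta * (x == i)%:R).
rewrite (@eq_iter_relabel_mean _ _ (fun f' => \prod_c u (f' c))); last first.
  by move=> f'; rewrite fiber_card_sum natr_sum mulr_sumr expR_sum.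
rewrite (iter_relabel_mean_prod _ (fun=> u)) (eq_bigr (fun=>
    1 + p * (1 - p) ^+ i * (expR theta - 1))).
  by rewrite prodr_const card_ord.
move=> c _; rewrite iter_age_mean /u.
have -> : (f c + M == i)%N = false by lia.
rewrite mulr0 expR0 mulr1.
have geomM := sum_geometric M; rewrite (bigD1 (Ordinal iM)) //= in geomM.
rewrite (bigD1 (Ordinal iM)) //= eqxx mulr1.
rewrite (eq_bigr (fun l : 'I_M => p * (1 - p) ^+ l)); last first.
  move=> l /negPf li; rewrite -val_eqE /= in li.
  by rewrite li mulr0 expR0 mulr1.
set rest := \sum_(l < M | _) _ in geomM *.
have -> : (1 - p) ^+ M = 1 - (p * (1 - p) ^+ i + rest) by rewrite geomM; ring.
by ring.
Qed.

End Average.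

(** * Finiteness of the set of partitions *)

Lemma intpart_size n (la : intpart n) : (size la <= n)%N.
Proof.
case: la => s /= /and3P[_ a1 /eqP <-].
by elim: s a1 => //= x s IH /andP[x1 /IH]; lia.
Qed.

(** There are at most [n] parts, so labels in ['I_n.+1] reach every partition. *)
Lemma intpart_enumP n : Finite.axiom
  (undup [seq shape_of (fun c => f c : nat) | f : {ffun 'I_n -> 'I_n.+1}]).
Proof.
apply: Finite.uniq_enumP; first exact: undup_uniq.
move=> la; rewrite mem_undup inE; apply/mapP.
exists [ffun c : 'I_n => inord (reshape_index la c)]; first by rewrite mem_enum.
rewrite -[LHS]shape_of_pile; congr shape_of; apply/funext => c.
rewrite ffunE inordK // ltnS; apply: leq_trans (intpart_size la).
by rewrite ltnW // reshape_indexP // sumn_intpart.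
Qed.

HB.instance Definition _ n :=
  fintype.isFinite.Build (intpart n) (@intpart_enumP n).

(** * From the Markov chain to averages *)

Section TotalProbability.
Context {R : realType} d (Omega : measurableType d) (P : probability Omega R).

Lemma total_probability (T : finType) (Y : Omega -> T) (A : set Omega) :
  measurable A -> (forall e, measurable (Y @^-1` [set e])) ->
  fine (P A) = \sum_e fine (P (A `&` Y @^-1` [set e])).
Proof.
move=> mA mY.
have mAY e : measurable (A `&` Y @^-1` [set e]) by exact: measurableI.
have fin B : measurable B -> P B \is a fin_num.
  by move=> mB; exact: (fin_num_measure P _ mB).
have mS (s : seq T) : measurable (A `&` Y @^-1` [set` s]).
  elim: s => [|e s IH].
    by rewrite (_ : _ `&` _ = set0) // -subset0 => w [].
  rewrite (_ : _ `&` _ =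
    (A `&` Y @^-1` [set e]) `|` (A `&` Y @^-1` [set` s])).
    exact: measurableU.
  rewrite -setIUr; congr (_ `&` _); apply/seteqP; split => w /=.
    by rewrite inE => /orP[/eqP|]; [left|right].
  by rewrite inE => -[->|->]; rewrite ?eqxx ?orbT.
suff PS (s : seq T) : uniq s ->
    fine (P (A `&` Y @^-1` [set` s])) =
    \sum_(e <- s) fine (P (A `&` Y @^-1` [set e])).
  rewrite -[RHS]big_enum -PS ?enum_uniq //; congr (fine (P _)).
  by apply/seteqP; split => [w Aw|w []//]; split=> //=; rewrite mem_enum.
elim: s => [|e s IH /= /andP[es us]].
  by move=> _; rewrite big_nil (_ : _ `&` _ = set0) ?measure0 // -subset0 => w [].
rewrite big_cons -IH // -fineD ?fin //; congr fine.
rewrite -measureU //.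
  congr (P _); rewrite -setIUr; congr (_ `&` _); apply/seteqP; split => w /=.
    by rewrite inE => /orP[/eqP|]; [left|right].
  by rewrite inE => -[->|->]; rewrite ?eqxx ?orbT.
by rewrite -subset0 => w [[_ /= Ye] [_ /=]]; rewrite Ye (negPf es).
Qed.

End TotalProbability.

Section Chain.
Context {R : realType} (n : nat) (p : R) d (Omega : measurableType d)
  (P : probability Omega R) (X : nat -> {RV P >-> intpart n}).
Hypothesis hX : markov_chain (solitaire_kernel p) X.

(** Starting at an arbitrary time [j] allows the conditions on earlier states to be dropped one at a
    time. *)
Let cylinder j k (s : nat -> intpart n) : set Omega :=
  [set w | forall i, (j <= i <= k)%N -> X i w = s i].

Let measurable_fiber k (A : set (intpart n)) : measurable (X k @^-1` A).
Proof. by rewrite -[X in measurable X]setTI; exact: measurable_funP. Qed.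

Let measurable_cylinder j k s : measurable (cylinder j k s).
Proof.
rewrite (_ : cylinder _ _ _ =
    \bigcap_(i in [set i | (j <= i <= k)%N]) X i @^-1` [set s i]).
  by apply: bigcap_measurableType => i _; exact: measurable_fiber.
by apply/seteqP; split.
Qed.

Let cylinder_recl j k s : (j <= k)%N ->
  fine (P (cylinder j.+1 k s)) =
  \sum_e fine (P (cylinder j k (fun i => if i == j then e else s i))).
Proof.
move=> jk; rewrite (@total_probability _ _ _ P _ (X j)) //.
apply: eq_bigr => e _; congr (fine (P _)).
apply/seteqP; split => [w [sw /= jw] i /andP[ji ik]|w sw /=].
  case: eqP => [->//|ij]; apply: sw; lia.
split=> [i /andP[ji ik]|].
  by have := sw i; case: eqP => [|_]; [lia|apply; lia].
by have := sw j; rewrite eqxx; apply; lia.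
Qed.

(** [markov_chain] gives [j = 0]. Summing over the state at time [j] moves the start to [j.+1],
    since the kernel factor involves only times [k] and [k.+1]. *)
Let cylinder_recr j k s : (j <= k)%N ->
  fine (P (cylinder j k.+1 s)) =
  fine (P (cylinder j k s)) * solitaire_kernel p (s k) (s k.+1).
Proof.
elim: j s => [|j IH] s jk.
  have := hX k s; rewrite -[X in P X]/(cylinder 0 k.+1 s) => ->.
  rewrite -[X in P X]/(cylinder 0 k s) fineM //.
  by apply: (fin_num_measure P); exact: measurable_cylinder.
rewrite !cylinder_recl; try lia.
rewrite mulr_suml; apply: eq_bigr => e _; rewrite IH; last lia.
have -> : (k == j) = false by lia.
by have -> : (k.+1 == j) = false by lia.
Qed.

Definition chain_mean k (h : intpart n -> R) : R :=
  \sum_la fine (P (X k @^-1` [set la])) * h la.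

Lemma solitaire_kernel_sum (h : intpart n -> R) la :
  \sum_mu solitaire_kernel p la mu * h mu = move_mean p h la.
Proof.
rewrite /move_mean (partition_big (solitaire_move la) xpredT) //=.
apply: eq_bigr => mu _; rewrite mulr_suml.
by apply: eq_bigr => S /eqP ->.
Qed.

Lemma chain_mean_succ k h : chain_mean k.+1 h = chain_mean k (move_mean p h).
Proof.
rewrite /chain_mean.
under [RHS]eq_bigr do rewrite -solitaire_kernel_sum mulr_sumr.
rewrite exchange_big; apply: eq_bigr => mu _ /=.
rewrite (@total_probability _ _ _ P _ (X k)) // mulr_suml.
apply: eq_bigr => la _; rewrite mulrA; congr (_ * _).
pose s i := if i == k then la else mu.
have := cylinder_recr s (leqnn k); rewrite /s eqxx gtn_eqF // => kernelE.
transitivity (fine (P (cylinder k k.+1 s))).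
  congr (fine (P _)); apply/seteqP; split=> w /=.
    move=> [X1 X0] i ik; rewrite /s; case: eqP => [->//|ik'].
    by have -> : i = k.+1 by lia.
  move=> sw; rewrite (sw k) ?leqnn ?leqnSn // (sw k.+1) ?leqnn ?leqnSn //.
  by rewrite /s eqxx gtn_eqF.
rewrite kernelE; congr (fine (P _) * _); apply/seteqP; split=> w /=.
  by move=> sw; rewrite sw ?leqnn // eqxx.
move=> Xw i ik; have -> : i = k by lia.
by rewrite eqxx.
Qed.

(** Isolates the last [M] moves; the law at time [k] stays arbitrary. *)
Lemma chain_mean_iter k M h :
  chain_mean (k + M) h = chain_mean k (iter M (move_mean p) h).
Proof.
elim: M h => [|M IH] h; first by rewrite addn0.
by rewrite addnS chain_mean_succ IH -iterSr.
Qed.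

Lemma chain_mean_indic k (A : set (intpart n)) :
  fine (P (X k @^-1` A)) = chain_mean k (\1_A).
Proof.
rewrite (@total_probability _ _ _ P _ (X k)) //; apply: eq_bigr => la _.
rewrite indicE; have [laA|laA] := boolP (la \in A).
  rewrite mulr1; congr (fine (P _)); apply/seteqP; split=> w /=; first by case.
  by move=> ->; split=> //; exact: set_mem.
rewrite mulr0 (_ : _ `&` _ = set0) ?measure0 // -subset0 => w /= [+ Xw].
by rewrite Xw => Ala; move: laA; rewrite notin_setE.
Qed.

Lemma chain_mean_cst k (c : R) : chain_mean k (fun=> c) = c.
Proof.
rewrite /chain_mean -mulr_suml; have := chain_mean_indic k setT.
rewrite /chain_mean preimage_setT probability_setT /=.
by under eq_bigr do rewrite indicE in_setT mulr1; move=> <-; rewrite mul1r.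
Qed.

Lemma chain_mean_le k h1 h2 : (forall la, h1 la <= h2 la) ->
  chain_mean k h1 <= chain_mean k h2.
Proof.
move=> h12; apply: ler_sum => la _; rewrite ler_wpM2l //.
by rewrite fine_ge0.
Qed.

End Chain.

(** * Concentration *)

Section RealInequalities.
Context {R : realType}.
Implicit Types x y p t : R.

(** The two sides agree at 0, and their difference has derivative
    [c ^+ 2 / ((1 + c) * (2 + c) ^+ 2)], which is nonnegative. *)
Lemma ln1Dx_ge x : 0 <= x -> 2 * x / (2 + x) <= ln (1 + x).
Proof.
move=> x0.
pose F : R -> R := fun y => ln (1 + y) - 2 * y / (2 + y).
have dF y : 0 <= y -> is_derive y (1:R) F ((1 + y)^-1 - 4 / (2 + y) ^+ 2).
  move=> y0.
  have y1 : 0 < 1 + y by lra.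
  have y2 : 2 + y != 0 by lra.
  have d1 : is_derive y (1:R) (fun z : R => 1 + z) (1 : R).
    apply: is_derive_eq (is_deriveD (is_derive_cst (1 : R) y (1 : R))
      (is_derive_id y (1 : R))) _.
    by rewrite add0r.
  have d2 : is_derive y (1:R) (fun z : R => 2 + z) (1 : R).
    apply: is_derive_eq (is_deriveD (is_derive_cst (2 : R) y (1 : R))
      (is_derive_id y (1 : R))) _.
    by rewrite add0r.
  have dln := is_derive1_comp (is_derive1_ln y1) d1.
  have dV := @is_deriveV R (fun z => 2 + z) y 1 1 y2 d2.
  have dM := is_deriveM (is_deriveZ 2 (is_derive_id y (1:R))) dV.
  apply: (is_derive_eq (is_deriveB dln dM)).
  rewrite /GRing.scale /= -[2 *: y]/(2 * y); field; rewrite y2 /=; lra.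
have dF' y : y \in `]0, x[ -> is_derive y (1:R) F ((1 + y)^-1 - 4 / (2 + y) ^+ 2).
  by rewrite in_itv /= => /andP[/ltW /dF].
have cF : {within `[0, x], continuous F}.
  apply: derivable_within_continuous => y; rewrite in_itv /= => /andP[/dF ? _].
  exact: ex_derive.
have [c + FE] := MVT_segment x0 dF' cF.
rewrite in_itv /= => /andP[c0 _].
have F0 : F 0 = 0 by rewrite /F addr0 ln1 mulr0 mul0r subr0.
suff : 0 <= F x by rewrite subr_ge0.
rewrite -[F x]subr0 -[X in _ - X]F0 FE subr0; apply: mulr_ge0 => //.
rewrite (_ : _ - _ = c ^+ 2 / ((1 + c) * (2 + c) ^+ 2)).
  by apply: divr_ge0; [exact: sqr_ge0|apply: mulr_ge0; [lra|exact: sqr_ge0]].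
by field; apply/andP; split; lra.
Qed.

(** The two sides agree at 0, and their difference has derivative [- 1 + y + expR (- y)], which is
    nonnegative. *)
Lemma expRN_le x : 0 <= x -> expR (- x) <= 1 - x + x ^+ 2 / 2.
Proof.
move=> x0.
pose F : R -> R := fun y => 1 - y + y ^+ 2 / 2 - expR (- y).
have dF (y : R) : is_derive y (1:R) F (- 1 + y + expR (- y)).
  have dN := is_deriveNid y (1:R).
  have dX := is_deriveX 2 (is_derive_id y (1:R)).
  have d2 := is_deriveZ (2^-1 : R) dX.
  have d1 := is_deriveD (is_derive_cst (1 : R) y (1 : R)) dN.
  have dE := is_derive1_comp (is_derive_expR (- y)) dN.
  have := is_deriveB (is_deriveD d1 d2) dE.
  rewrite (_ : (cst 1 + _ + _ - _ : R -> R) = F); last first.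
    apply/funext => z; rewrite /F. by rewrite [X in _ = _ + X - _]mulrC.
  move=> dF; apply: (is_derive_eq dF); rewrite /GRing.scale /=.
  by field.
have cF : {within `[0, x], continuous F}.
  by apply: derivable_within_continuous => y _; exact: ex_derive.
have [c _ FE] := MVT_segment x0 (fun y _ => dF y) cF.
have F0 : F 0 = 0 by rewrite /F oppr0 expR0 expr0n /=; ring.
suff : 0 <= F x by rewrite subr_ge0.
rewrite -[F x]subr0 -[X in _ - X]F0 FE subr0; apply: mulr_ge0 => //.
by have := expR_ge1Dx (- c); lra.
Qed.

Lemma expR_sub1_ge x : 0 <= expR x - 1 - x.
Proof. by have := expR_ge1Dx x; lra. Qed.

(** The Chernoff exponent, in units of [n p], for a deviation of [x] times [n p]. *)
Definition rate x : R := x ^+ 2 / (2 + x).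

Lemma rate_gt0 x : 0 < x -> 0 < rate x.
Proof. by move=> x0; rewrite divr_gt0 ?exprn_gt0 //; lra. Qed.

Lemma rate_le x y : 0 <= x -> x <= y -> rate x <= rate y.
Proof.
move=> x0 xy; rewrite /rate ler_pdivrMr; last lra.
rewrite mulrAC ler_pdivlMr; last lra.
have x2y2 : x ^+ 2 <= y ^+ 2 by rewrite ler_sqr ?nnegrE; lra.
have : x * y * x <= x * y * y by rewrite ler_wpM2l // mulr_ge0 //; lra.
lra.
Qed.

(** With [t = ln (1 + x)] the coefficient of [q] is [expR t - 1 - t], hence nonnegative, so [q = 1]
    is the worst case; there [ln1Dx_ge] yields [rate x]. *)
Lemma chernoff_upper x q : 0 <= x -> 0 <= q <= 1 ->
  q * (expR (ln (1 + x)) - 1) - ln (1 + x) * (q + x) <= - rate x.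
Proof.
move=> x0 /andP[q0 q1]; set t := ln (1 + x).
have et := expR_sub1_ge t.
apply: (@le_trans _ _ (expR t - 1 - t - t * x)).
  have : q * (expR t - 1 - t) <= 1 * (expR t - 1 - t) by rewrite ler_wpM2r.
  lra.
have t_ge := ln1Dx_ge x0; rewrite -/t in t_ge.
have -> : expR t = 1 + x by rewrite lnK // posrE; lra.
have : 2 * x / (2 + x) * (1 + x) <= t * (1 + x) by rewrite ler_wpM2r //; lra.
suff -> : 2 * x / (2 + x) * (1 + x) = x + rate x by lra.
by rewrite /rate; field; lra.
Qed.

(** Again [q = 1] is the worst case; [expRN_le] gives the exponent [x ^+ 2 / 2], at least
    [rate x]. *)
Lemma chernoff_lower x q : 0 <= x -> 0 <= q <= 1 ->
  q * (expR (- x) - 1) + x * (q - x) <= - rate x.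
Proof.
move=> x0 /andP[q0 q1].
have et := expR_sub1_ge (- x).
apply: (@le_trans _ _ (expR (- x) - 1 + x - x ^+ 2)).
  have : q * (expR (- x) - 1 - - x) <= 1 * (expR (- x) - 1 - - x).
    by rewrite ler_wpM2r.
  lra.
have le2 := expRN_le x0.
suff : rate x <= x ^+ 2 / 2 by lra.
by rewrite /rate ler_wpM2l ?sqr_ge0 // lef_pV2 ?posrE; lra.
Qed.

Lemma expr1B_le p (k : nat) : p <= 1 -> (1 - p) ^+ k <= expR (- (k%:R * p)).
Proof.
move=> p1; rewrite -mulrN expRM_natl lerXn2r ?nnegrE ?expR_ge0 ?subr_ge0 //.
exact: expR_ge1Dx.
Qed.

(** Replacing [(1 - p) ^+ k] by [expR (- (k%:R * p))], and then that by [expR (- x)], makes errors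
    of opposite signs, each at most [p], so they do not add up. *)
Lemma expr1B_close p (k : nat) x : 0 <= p <= 1 ->
  k%:R * p <= x <= k.+1%:R * p -> `|(1 - p) ^+ k - expR (- x)| <= p.
Proof.
move=> /andP[p0 p1] /andP[kx xk].
have up := expr1B_le k p1.
have e_le1 (y : R) : 0 <= y -> expR (- y) <= 1.
  by move=> y0; rewrite -expR0 ler_expR oppr_le0.
(* Each factor adds at most [p ^+ 2 / 2] and [1 - p] contracts the previous error:
   [(1 - p) * p + p ^+ 2 / 2 <= p]. *)
have low : expR (- (k%:R * p)) - (1 - p) ^+ k <= p.
  rewrite -mulrN expRM_natl; elim: (k) => [|j IH]; first by rewrite subrr.
  have ep := expRN_le p0.
  have p2 : 0 <= p ^+ 2 by exact: sqr_ge0.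
  have : (1 - p) * (expR (- p) ^+ j - (1 - p) ^+ j) <= (1 - p) * p.
    by rewrite ler_wpM2l // subr_ge0.
  have : expR (- p) ^+ j * (expR (- p) - (1 - p)) <= 1 * (p ^+ 2 / 2).
    apply: ler_pM; [exact: exprn_ge0 (expR_ge0 _)| | |lra].
      by have := expR_ge1Dx (- p); lra.
    by rewrite -expRM_natl mulrN e_le1 // mulr_ge0.
  rewrite !exprSr; lra.
rewrite ler_norml; apply/andP; split.
  suff : expR (- x) <= expR (- (k%:R * p)) by lra.
  by rewrite ler_expR lerN2.
have : expR (- (k.+1%:R * p)) <= expR (- x) by rewrite ler_expR lerN2.
have -> : - (k.+1%:R * p) = - (k%:R * p) - p by rewrite -natr1; ring.
rewrite expRD; have := expR_ge1Dx (- p).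
have := e_le1 _ (mulr_ge0 (ler0n R k) p0).
have := expR_ge0 (- (k%:R * p)).
move: up low; move: (expR (- (k%:R * p))) (expR (- p)) => a b; nra.
Qed.

End RealInequalities.

(** * Chernoff bounds for the piles and the union bound *)

Section UnionBound.
Context {R : realType} (n : nat) (p : R).
Implicit Types (f : 'I_n -> nat).
Hypothesis p01 : 0 <= p <= 1.

Let q01 i : 0 <= (1 - p) ^+ i <= 1.
Proof.
by case/andP: p01 => p0 p1; apply/andP; split;
  [rewrite exprn_ge0 // subr_ge0|rewrite exprn_ile1 //; lra].
Qed.

(* A negative theta gives the lower tail. *)
Lemma chernoff_fiber M f (i : nat) (theta t : R) : (i < M)%N ->
  iter M (relabel_mean p)
    (fun f' => (theta * t <= theta * (fiber_card f' i)%:R)%R%:R) f <=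
  expR (n%:R * p * (1 - p) ^+ i * (expR theta - 1) - theta * t).
Proof.
move=> iM; case/andP: p01 => p0 p1; case/andP: (q01 i) => q0 q1.
(* Markov's inequality in exponential form. *)
apply: (@le_trans _ _ (iter M (relabel_mean p) (fun f' =>
    expR (- (theta * t)) * expR (theta * (fiber_card f' i)%:R)) f)).
  apply: iter_relabel_mean_le => // f'; rewrite -expRD.
  have [le|_] := boolP (theta * t <= _)%R; rewrite ?mulr0n ?expR_ge0 // mulr1n.
  by rewrite -[leLHS]expR0 ler_expR; lra.
rewrite iter_relabel_meanZ iter_relabel_mean_expR // expRD [leRHS]mulrC.
rewrite ler_wpM2l ?expR_ge0 // -!mulrA expRM_natl lerXn2r ?nnegrE ?expR_ge0 //.
  have e0 := expR_ge0 theta.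
  have : p * (1 - p) ^+ i <= 1 by rewrite mulr_ile1.
  have : 0 <= p * (1 - p) ^+ i by rewrite mulr_ge0.
  rewrite mulrA; nra.
exact: expR_ge1Dx.
Qed.

(** After [M] moves, the first condition says that every card was picked during them. Strictness in
    the second makes its failure a Chernoff event. *)
Definition close_to_geometric (M : nat) (eta : R) f : bool :=
  [forall c, f c < M]%N &&
  [forall i : 'I_M, `|(fiber_card f i)%:R - n%:R * p * (1 - p) ^+ i|
                    < n%:R * p * eta].

(** Union bound: each of the [n] cards may stay unpicked, and each of the [M] piles has an upper and
    a lower tail. *)
Lemma close_to_geometric_mean M eta f : 0 <= eta ->
  1 - n%:R * (1 - p) ^+ M - 2 * M%:R * expR (- (n%:R * p * rate eta)) <=
  iter M (relabel_mean p) (fun f' => (close_to_geometric M eta f')%:R) f.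
Proof.
move=> eta0; case/andP: (p01) => p0 p1.
have np0 : 0 <= n%:R * p by rewrite mulr_ge0.
set E := expR _.
pose old (c : 'I_n) (f' : 'I_n -> nat) : R := (M <= f' c)%:R.
pose dev theta (s : R) (i : 'I_M) (f' : 'I_n -> nat) : R :=
  (theta * (n%:R * p * ((1 - p) ^+ i + s)) <= theta * (fiber_card f' i)%:R)%R%:R.
pose theta := ln (1 + eta).
have union f' : 1 <= (close_to_geometric M eta f')%:R +
    (\sum_c old c f' +
     (\sum_i dev theta eta i f' + \sum_i dev (- eta) (- eta) i f')).
  have old0 : 0 <= \sum_c old c f' by apply: sumr_ge0.
  have dev0 th s : 0 <= \sum_i dev th s i f' by apply: sumr_ge0.
  have := dev0 theta eta; have := dev0 (- eta) (- eta).
  have [good|] := boolP (close_to_geometric _ _ _); first by rewrite mulr1n; lra.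
  rewrite mulr0n negb_and => /orP[/forallPn[c]|/forallPn[i]].
    rewrite -leqNgt => Mc.
    suff : 1 <= \sum_c old c f' by lra.
    rewrite (bigD1 c) //= /old Mc lerDl; exact: sumr_ge0.
  rewrite -leNgt ler_normr => /orP[dev1|dev1].
    suff : 1 <= \sum_i dev theta eta i f' by lra.
    have d1 : theta * (n%:R * p * ((1 - p) ^+ i + eta))
        <= theta * (fiber_card f' i)%:R.
      by apply: ler_wpM2l; [rewrite ln_ge0 // lerDl|lra].
    by rewrite (bigD1 i) //= [X in X + _]/dev d1 lerDl; exact: sumr_ge0.
  suff : 1 <= \sum_i dev (- eta) (- eta) i f' by lra.
  have d1 : - eta * (n%:R * p * ((1 - p) ^+ i - eta))
      <= - eta * (fiber_card f' i)%:R.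
    by rewrite !mulNr lerN2; apply: ler_wpM2l => //; lra.
  by rewrite (bigD1 i) //= [X in X + _]/dev d1 lerDl; exact: sumr_ge0.
have mean_old : iter M (relabel_mean p) (fun f' => \sum_c old c f') f =
    n%:R * (1 - p) ^+ M.
  rewrite iter_relabel_mean_sum; under eq_bigr do rewrite iter_relabel_mean_unpicked.
  by rewrite sumr_const card_ord mulr_natl.
have mean_dev th s : (forall i : 'I_M,
      (1 - p) ^+ i * (expR th - 1) - th * ((1 - p) ^+ i + s) <= - rate eta) ->
    iter M (relabel_mean p) (fun f' => \sum_i dev th s i f') f <= M%:R * E.
  move=> Hth; rewrite iter_relabel_mean_sum.
  apply: (@le_trans _ _ (\sum_(i < M) E)); last first.
    by rewrite sumr_const card_ord mulr_natl.
  apply: ler_sum => i _; apply: (le_trans (chernoff_fiber _ _ _ (ltn_ord i))).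
  rewrite ler_expR; have := ler_wpM2l np0 (Hth i).
  by move: ((1 - p) ^+ i) => q; lra.
have up := mean_dev theta eta (fun i => chernoff_upper eta0 (q01 i)).
have low : iter M (relabel_mean p)
    (fun f' => \sum_i dev (- eta) (- eta) i f') f <= M%:R * E.
  apply: mean_dev => i; have := chernoff_lower eta0 (q01 i); lra.
have := iter_relabel_mean_le p01 M f union.
rewrite iter_relabel_mean_cst !iter_relabel_meanD mean_old; lra.
Qed.

(** Here [eta] bounds the error of the pile sizes in units of [n p], and [p] that of replacing the
    geometric profile by the exponential. *)
Lemma close_to_geometric_shape M eta eps f : (0 < n)%N -> 0 < p ->
  close_to_geometric M eta f -> (1 - p) ^+ M <= eta -> eta + p <= eps ->
  (sup_norm_ge0 (diagram_boundary p^-1 (shape_of f)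
     \- (fun x => expR (- x)))%R <= eps%:E)%E.
Proof.
move=> n0 p0 /andP[/forallP fM /forallP fq] qM etap; case/andP: (p01) => _ p1.
have np0 : 0 < n%:R * p by rewrite mulr_gt0 // ltr0n.
have q_noninc i j : (i <= j)%N ->
    n%:R * p * (1 - p) ^+ j <= n%:R * p * (1 - p) ^+ i.
  by move=> ij; rewrite ler_wpM2l ?(ltW np0) // ler_wiXn2l //; lra.
have close l : `|(fiber_card f l)%:R - n%:R * p * (1 - p) ^+ l| <= n%:R * p * eta.
  (* Labels from [M] on carry no card, and there the profile is at most [n p eta] by the bound on
     [(1 - p) ^+ M]. *)
  have [lM|Ml] := ltnP l M; first exact: ltW (fq (Ordinal lM)).
  have -> : fiber_card f l = 0%N.
    apply/eqP; rewrite -leqn0 leqNgt -has_count has_pred1.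
    by apply/codomP => -[c lc]; have := fM c; rewrite -lc ltnNge Ml.
  rewrite sub0r normrN ger0_norm; last first.
    by rewrite mulr_ge0 ?(ltW np0) // (andP (q01 l)).1.
  by apply: le_trans (q_noninc _ _ Ml) _; rewrite ler_wpM2l // ltW.
apply: ge_ereal_sup => _ [x /= x0 <-]; rewrite lee_fin.
set k := Num.truncn (p^-1 * x).
have xk : k%:R * p <= x <= k.+1%:R * p.
  have := truncn_itv (_ : 0 <= p^-1 * x).
  rewrite -/k mulr_ge0 ?invr_ge0 ?(ltW p0) // => /(_ isT) /andP[k1 k2].
  move: k1 k2; rewrite mulrC ler_pdivlMr // ltr_pdivrMr // => -> /ltW ->.
  done.
have := shape_of_close q_noninc close k.
rewrite /diagram_boundary -/k; set la := (intpart_nth _ _)%:R => la_close.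
have := expr1B_close p01 xk; set q := (1 - p) ^+ k => q_close.
have -> : p^-1 / n%:R * la = la / (n%:R * p) by rewrite invfM; ring.
have la_q : `|la / (n%:R * p) - q| <= eta.
  have -> : la / (n%:R * p) - q = (la - n%:R * p * q) / (n%:R * p).
    by field; rewrite !lt0r_neq0 // ltr0n.
  by rewrite normrM normfV (gtr0_norm np0) ler_pdivrMr // [eta * _]mulrC.
apply: le_trans etap; apply: le_trans (lerD la_q q_close).
by apply: le_trans (ler_normD _ _); rewrite addrA subrK.
Qed.

End UnionBound.

(** With [E] the exponential in the bound, the constant collects [n E] from unpicked cards and
    [2 M E <= (2 * rate eps + 2) n E] from the piles. *)
Lemma solitaire_tail (R : realType) (n : nat) (p eps : R)
    d (Omega : measurableType d) (P : probability Omega R)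
    (X : nat -> {RV P >-> intpart n}) (m : nat) :
  (0 < n)%N -> 0 < p < 1 -> markov_chain (solitaire_kernel p) X ->
  p <= eps -> rate eps * n%:R < m%:R ->
  expR (- (rate eps * (n%:R * p))) <= eps - p ->
  ((1 - (2 * rate eps + 3) * n%:R * expR (- (n%:R * p * rate (eps - p))))%:E
   <= P [set w | (sup_norm_ge0 (diagram_boundary p^-1 (X m w)
                    \- (fun x => expR (- x)))%R <= eps%:E)%E])%E.
Proof.
move=> n0 /andP[p0 p1] hX peps hm heta.
have p01 : 0 <= p <= 1 by rewrite !ltW.
have eps0 : 0 < eps by lra.
set c := rate eps in hm heta *.
have c0 : 0 < c by exact: rate_gt0.
(* The least integer above [c n]: it is at most [m], and only of order [n], as the union bound
   requires. *)
set M := (Num.truncn (c * n%:R)).+1.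
have cn0 : 0 <= c * n%:R by rewrite mulr_ge0 // ltW.
have Mm : (M <= m)%N by rewrite truncn_lt_nat.
have /andP[Mlow Mup] := truncn_itv cn0.
rewrite -/M in Mup.
set A := [set la : intpart n | (sup_norm_ge0 (diagram_boundary p^-1 la
                    \- (fun x => expR (- x)))%R <= eps%:E)%E].
rewrite -[X in P X]/(X m @^-1` A).
have mA : measurable (X m @^-1` A).
  by rewrite -[X in measurable X]setTI; exact: measurable_funP.
rewrite -[leRHS]fineK; last exact: (fin_num_measure P _ mA).
rewrite lee_fin (chain_mean_indic X) -(subnK Mm) (chain_mean_iter hX).
set eta := eps - p in heta *.
set E := expR (- (n%:R * p * rate eta)).
rewrite -[leLHS](chain_mean_cst X (m - M)); apply: chain_mean_le => la.
rewrite -[X in iter _ _ _ X]shape_of_pile iter_move_mean_shape //.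
have eta0 : 0 <= eta by rewrite subr_ge0.
have decay : (1 - p) ^+ M <= expR (- (c * (n%:R * p))).
  apply: (le_trans (expr1B_le M (ltW p1))).
  by rewrite ler_expR lerN2 mulrA ler_wpM2r ?(ltW p0) // ltW.
apply: le_trans (iter_relabel_mean_le p01 M _
  (h1 := fun f' => (close_to_geometric p M eta f')%:R) _); last first.
  move=> f' /=; rewrite indicE; have [good|_] := boolP (close_to_geometric _ _ _ _).
    rewrite mem_set //; apply: (close_to_geometric_shape (eta := eta) p01 n0 p0 good).
      exact: le_trans decay heta.
    by rewrite subrK.
  exact: ler0n.
apply: le_trans (close_to_geometric_mean _ _ _ eta0) => //.
have E0 : 0 <= E by exact: expR_ge0.
(* As [eta <= eps], monotonicity of [rate] bounds the unpicked cards by the same [E]. *)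
have decayE : (1 - p) ^+ M <= E.
  apply: (le_trans decay); rewrite ler_expR lerN2 mulrC ler_wpM2r //.
    by rewrite mulr_ge0 // ltW.
  by rewrite rate_le // /eta; lra.
have : n%:R * (1 - p) ^+ M <= n%:R * E by rewrite ler_wpM2l.
have : 2 * M%:R * E <= (2 * c + 2) * n%:R * E.
  rewrite ler_wpM2r //.
  have : M%:R <= c * n%:R + 1 by rewrite -natr1 lerD2r.
  have : 1 <= n%:R :> R by rewrite ler1n.
  lra.
rewrite -/E; lra.
Qed.

(** * Asymptotics *)

Section Asymptotics.
Context {R : realType} (p : nat -> R).
Hypothesis hp : forall n, (0 < n)%N -> 0 < p n < 1.
Hypothesis hpoo : p n / (ln n%:R / n%:R) @[n --> \oo] --> +oo.

Lemma cvg_ln_div_np : ln n%:R / (n%:R * p n) @[n --> \oo] --> (0 : R).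
Proof.
have vE n : ln n%:R / (n%:R * p n) = (p n / (ln n%:R / n%:R))^-1 :> R.
  by rewrite invf_div invfM mulrA.
apply/cvgr0Pnorm_le => e e0; move/cvgryPge/(_ e^-1): hpoo.
apply: filterS => n he; have f0 := lt_le_trans (_ : 0 < e^-1) he.
rewrite vE gtr0_norm; last by rewrite invr_gt0 f0 // invr_gt0.
by rewrite -[e]invrK lef_pV2 // posrE ?f0 ?invr_gt0.
Qed.

(** For [n >= 2], [ln n >= ln 2], so [cvg_ln_div_np] dominates. *)
Lemma cvg_inv_np : (n%:R * p n)^-1 @[n --> \oo] --> (0 : R).
Proof.
have ln2 : 0 < ln 2 :> R by rewrite ln_gt0 // ltr1n.
apply: (@squeeze_cvgr _ _ _ _ (fun=> 0)
  (fun n => (ln 2)^-1 * (ln n%:R / (n%:R * p n)))).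
- near=> n; have n2 : (2 <= n)%N by near: n; exact: nbhs_infty_ge.
  have n0 : (0 < n)%N by exact: ltn_trans n2.
  have /andP[p0 _] := hp n0.
  have np0 : 0 < n%:R * p n by rewrite mulr_gt0 // ltr0n.
  apply/andP; split; first by rewrite invr_ge0 ltW.
  rewrite mulrA ler_pMl ?invr_gt0 // -[leLHS](mulVf (lt0r_neq0 ln2)).
  by rewrite ler_wpM2l ?invr_ge0 ?(ltW ln2) // ler_ln ?posrE ?ltr0n // ler_nat.
- exact: cvg_cst.
- rewrite -[0](mulr0 (ln 2)^-1).
  by apply: cvgM; [exact: cvg_cst|exact: cvg_ln_div_np].
Unshelve. all: by end_near. Qed.

End Asymptotics.

Lemma expRN_le_inv (R : realType) (x : R) : 0 < x -> expR (- x) <= x^-1.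
Proof.
move=> x0; rewrite expRN lef_pV2 ?posrE ?expR_gt0 //.
by have := expR_ge1Dx x; lra.
Qed.

(** * The exponential bound with its vanishing correction *)

Section Concentration.
Context {R : realType} (p : nat -> R).
Hypothesis hp : forall n, (0 < n)%N -> 0 < p n < 1.
Context (d : nat -> measure_display) (Omega : forall n, measurableType (d n))
  (P : forall n, probability (Omega n) R)
  (X : forall n, nat -> {RV (P n) >-> intpart n}).
Hypothesis hX :
  forall n, (0 < n)%N -> markov_chain (solitaire_kernel (p n)) (X n).
Hypothesis hp0 : p n @[n --> \oo] --> (0 : R).
Hypothesis hpoo : p n / (ln n%:R / n%:R) @[n --> \oo] --> +oo.

Lemma solitaire_concentration (eps : R) (m : nat -> nat) : 0 < eps ->
  (forall n, (0 < n)%N -> rate eps * n%:R < (m n)%:R) ->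
  exists o : nat -> R,
    o n @[n --> \oo] --> (0 : R) /\
    forall n, (0 < n)%N ->
      ((1 - expR (- (rate eps * (n%:R * p n) * (1 - o n))))%:E
       <= P n [set w | (sup_norm_ge0 (diagram_boundary (p n)^-1 (X n (m n) w)
                                  \- (fun x => expR (- x)))%R <= eps%:E)%E])%E.
Proof.
move=> eps0 hm; set c := rate eps; have c0 : 0 < c by exact: rate_gt0.
pose u n : R := (n%:R * p n)^-1.
pose v n : R := ln n%:R / (n%:R * p n).
have u_cvg : u n @[n --> \oo] --> (0 : R) by exact: cvg_inv_np.
have v_cvg : v n @[n --> \oo] --> (0 : R) by exact: cvg_ln_div_np.
(* The conditions of [solitaire_tail] that are only known for large [n]. *)
pose good n := [&& (0 < n)%N, p n <= eps
  & expR (- (c * (n%:R * p n))) <= eps - p n].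
(* Solves [(2 c + 3) n expR (- n p rate (eps - p)) = expR (- c n p (1 - o1 n))]; the logarithm of
   the prefactor divided by [n p] is [ln (2 c + 3) * u n + v n]. *)
pose o1 n := 1 - (rate (eps - p n) - (ln (2 * c + 3) * u n + v n)) / c.
(* The value 1 makes the lower bound [1 - expR 0 = 0] at the other [n]. *)
pose o n := if good n then o1 n else 1.
have near_good : \forall n \near \oo, good n.
  near=> n; have n0 : (0 < n)%N by near: n; exact: nbhs_infty_gt.
  have /andP[pn0 _] := hp n0.
  have np0 : 0 < n%:R * p n by rewrite mulr_gt0 // ltr0n.
  have pn : `|p n| <= eps / 2.
    by near: n; move/cvgr0Pnorm_le : hp0; apply; rewrite divr_gt0.
  have un : `|u n| <= c * (eps / 2).
    near: n; move/cvgr0Pnorm_le : u_cvg; apply.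
    by rewrite mulr_gt0 // divr_gt0.
  rewrite gtr0_norm // in pn; rewrite gtr0_norm ?invr_gt0 // in un.
  apply/and3P; split => //; first lra.
  apply: (le_trans (expRN_le_inv (mulr_gt0 c0 np0))).
  suff : (c * (n%:R * p n))^-1 <= eps / 2 by lra.
  by rewrite invfM mulrC ler_pdivrMr // [_ * c]mulrC.
exists o; split.
  have o1_cvg : o1 n @[n --> \oo] --> (0 : R).
    have -> : 0 = 1 - (rate eps - (ln (2 * c + 3) * 0 + 0)) / c :> R.
      by rewrite mulr0 addr0 subr0 divff ?subrr // lt0r_neq0.
    apply: cvgB; first exact: cvg_cst.
    apply: cvgM; last exact: cvg_cst.
    apply: cvgB; last first.
      by apply: cvgD v_cvg; apply: cvgM u_cvg; exact: cvg_cst.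
    have eta_cvg : eps - p n @[n --> \oo] --> eps.
      by rewrite -[X in _ --> X]subr0; apply: cvgB hp0; exact: cvg_cst.
    apply: cvgM; first by rewrite /= expr2; apply: cvgM.
    apply: cvgV; first by rewrite lt0r_neq0; lra.
    by apply: cvgD eta_cvg; exact: cvg_cst.
  apply: cvg_trans o1_cvg; apply: near_eq_cvg.
  by apply: filterS near_good => n; rewrite /o => ->.
move=> n n0; rewrite /o; case: ifPn => [/and3P[_ pn en]|_]; last first.
  by rewrite subrr mulr0 oppr0 expR0 subrr measure_ge0.
apply: le_trans (solitaire_tail n0 (hp n0) (hX n0) pn (hm n n0) en).
have /andP[pn0 _] := hp n0.
have np0 : 0 < n%:R * p n by rewrite mulr_gt0 // ltr0n.
rewrite lee_fin lerD2l lerN2 le_eqVlt; apply/orP; left; apply/eqP.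
have n0R : 0 < n%:R :> R by rewrite ltr0n.
have K0 : 0 < 2 * c + 3 by lra.
have -> : (2 * c + 3) * n%:R = expR (ln (2 * c + 3) + ln n%:R).
  by rewrite expRD !lnK.
rewrite -expRD; congr expR; rewrite /o1 /u /v -/c.
by field; rewrite !lt0r_neq0.
Unshelve. all: by end_near. Qed.

End Concentration.

Theorem theorem1 (R : realType) (p : nat -> R)
  (hp : forall n, (0 < n)%N -> 0 < p n < 1)
  (d : nat -> measure_display) (Omega : forall n, measurableType (d n))
  (P : forall n, probability (Omega n) R)
  (X : forall n, nat -> {RV (P n) >-> intpart n})
  (hX : forall n, (0 < n)%N -> markov_chain (solitaire_kernel (p n)) (X n))
  (hp0 : p n @[n --> \oo] --> (0 : R))
  (hpoo : p n / (ln n%:R / n%:R) @[n --> \oo] --> +oo)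
  (eps : R) (heps : 0 < eps) (m : nat -> nat)
  (hm : forall n, (0 < n)%N -> eps ^+ 2 / (2 + eps) * n%:R < (m n)%:R) :
  limit_shape (fun n => distribution (P n) (X n (m n)))
    (fun x => expR (- x)) (fun n => (p n)^-1)
  /\
  exists o : nat -> R,
    o n @[n --> \oo] --> (0 : R) /\
    forall n, (0 < n)%N ->
      ((1 - expR (- (eps ^+ 2 / (2 + eps) * (n%:R * p n) * (1 - o n))))%:E
       <= P n [set w | (sup_norm_ge0 (diagram_boundary (p n)^-1 (X n (m n) w)
                                  \- (fun x => expR (- x)))%R <= eps%:E)%E])%E.
Proof.
split; last exact: solitaire_concentration.
split=> [x _|n n0|delta delta0].
- exact: expR_ge0.
- by have /andP[p0 _] := hp n n0; rewrite invr_gt0.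
(* Shrinking [eps] preserves the bound on [m], since [rate] is monotone; [delta / 2] provides the
   strict inequality. *)
set eps' := Num.min eps (delta / 2).
have eps'0 : 0 < eps' by rewrite lt_min heps divr_gt0.
have hm' n : (0 < n)%N -> rate eps' * n%:R < (m n)%:R.
  move=> n0; apply: le_lt_trans (hm n n0); rewrite ler_wpM2r //.
  by apply: rate_le; rewrite ?ge_min ?lexx // ltW.
have [r [r_cvg hr]] := solitaire_concentration hp hX hp0 hpoo eps'0 hm'.
set c := rate eps' in hr; have c0 : 0 < c by exact: rate_gt0.
have u_cvg := cvg_inv_np hp hpoo.
(* Eventually [r n <= 1 / 2], so the failure probability is at most [expR (- c n p / 2)], hence at
   most [2 / (c n p)]. *)
apply: (@squeeze_cvge _ _ _ _
  (fun n => (1 - 2 / c * (n%:R * p n)^-1)%:E) _ (fun=> 1%E)).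
- near=> n; have n0 : (0 < n)%N by near: n; exact: nbhs_infty_gt.
  have /andP[pn0 _] := hp n n0.
  have np0 : 0 < n%:R * p n by rewrite mulr_gt0 // ltr0n.
  have r_le : `|r n| <= 1 / 2.
    by near: n; move/cvgr0Pnorm_le : r_cvg; apply; lra.
  have mX A : measurable (X n (m n) @^-1` A).
    by rewrite -[X in measurable X]setTI; exact: measurable_funP.
  apply/andP; split; last exact: probability_le1.
  apply: (@le_trans _ _ (1 - expR (- (c * (n%:R * p n) * (1 - r n))))%:E).
    rewrite lee_fin lerD2l lerN2.
    have half : 0 < c * (n%:R * p n) / 2 by rewrite divr_gt0 // mulr_gt0.
    have -> : 2 / c * (n%:R * p n)^-1 = (c * (n%:R * p n) / 2)^-1.
      by field; rewrite !lt0r_neq0 // ltr0n.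
    apply: le_trans (expRN_le_inv half); rewrite ler_expR lerN2.
    rewrite ler_wpM2l ?(ltW (mulr_gt0 c0 np0)) //.
    by move: r_le; rewrite ler_norml => /andP[_]; lra.
  pose S (Q : pred (\bar R)) := X n (m n) @^-1` [set la | Q (sup_norm_ge0
    (diagram_boundary (p n)^-1 la \- (fun x => expR (- x)))%R)].
  have PS : (P n (S (fun y => y <= eps'%:E)%E) <= P n (S (fun y => y < delta%:E)%E))%E.
    apply: le_measure; [exact: mem_set (mX _)|exact: mem_set (mX _)|].
    move=> w /= /le_lt_trans; apply; rewrite lte_fin gt_min; apply/orP; right.
    lra.
  apply: (le_trans (hr n n0)).
  exact: PS.
- rewrite -[X in _ --> X%:E](subr0 1) -(mulr0 (2 / c)).
  apply: cvg_EFin; first by near=> n.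
  apply: cvgB; first exact: cvg_cst.
  by apply: cvgM => //; exact: cvg_cst.
- exact: cvg_cst.
Unshelve. all: by end_near. Qed.
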